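(* Let $\Phi$ be a gradient local semiflow on a complete metric space $X$ and let $(N,E)$ be a transversal Ważewski pair for $\Phi$ with $E\subset N$. Suppose that $N$ is an ANE. Then $N\setminus E$ contains at least $\mathrm{cat}_{N,E}(N)$ equilibria of $\Phi$, and also at least $\mathrm{cat}_{N/E,[E]}(N/E)$ equilibria of $\Phi$.
   Context: Local semiflow: a continuous map $\Phi:\mathcal D(\Phi)\to X$, with $\mathcal D(\Phi)$ open in $\mathbb R^+\times X$ ($\mathbb R^+=[0,\infty)$), such that for each $x\in X$ there is $0<T_x\leqslant\infty$ with $(t,x)\in\mathcal D(\Phi)\iff 0\leqslant t<T_x$; $\Phi(0,x)=x$; and $\Phi(t+s,x)=\Phi(t,\Phi(s,x))$ whenever $(t+s,x)\in\mathcal D(\Phi)$, $t,s\geqslant 0$. Write $\Phi(t)x=\Phi(t,x)$. An equilibrium is a point $x$ with $\Phi(t)x=x$ for all $t\geqslant0$. $\Phi$ is gradient if there is a continuous $V:X\to\mathbb R$ such that $t\mapsto V(\Phi(t)x)$ is non-increasing for each $x\in X$, and if $V(\Phi(t)x)=V(x)$ for all $t\geqslant0$ then $x$ is an equilibrium. For $N\subset X$ put $t_N(x)=\inf\{t\geqslant0: t\geqslant T_x\text{ or }\Phi(t)x\notin N\}$ (with $\inf\emptyset=\infty$). A set $E$ is $N$-positively invariant if for all $x\in N\cap E$, $t\geqslant0$, $\Phi([0,t])x\subset N$ implies $\Phi([0,t])x\subset E$. $E$ is an exit set of $N$ if (1) $E$ is $N$-positively invariant and (2) for every $x\in N$ with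 $t_N(x)<T_x$ there is $t\leqslant t_N(x)$ with $\Phi(t)x\in E$. A set $A$ is admissible if for all sequences $x_n\in A$, $t_n\to+\infty$ with $\Phi([0,t_n])x_n\subset A$, the sequence $\Phi(t_n)x_n$ has a convergent subsequence; $A$ is strongly admissible if moreover $T_x=\infty$ whenever $\Phi(t)x\in A$ for all $t\in[0,T_x)$. A pair $(N,E)$ of closed subsets of $X$ is a Ważewski pair if $E$ is an exit set of $N$ and $\overline{N\setminus E}$ is strongly admissible. With $H=\overline{N\setminus E}$, the pair is transversal if for every $x\in H\cap E$ and $t>0$ there is $s\in(0,t)$ with $\Phi(s)x\notin H\cap E$. Quotient: if $E\ne\emptyset$, $N/E$ is the quotient topological space obtained from $N$ by collapsing $E$ to a single point $[E]$; if $E=\emptyset$, $N/E=N\cup\{*\}$ with the sum topology, where $*\notin N$ is an extra isolated point, denoted $[E]$. Relative category: let $Z$ be a topological space, $I=[0,1]$. A closed set $A\subset Z$ is contractible in $Z$ if there is a continuous $h:I\times A\to Z$ with $h(0,u)=u$ and $h(1,u)=h(1,v)$ for all $u,v\in A$. For closed $A,B,Y\subset Z$, $A\prec_Y B$ in $Z$ means $Y\subset A\cap B$ and there is a continuous $h:I\times A\to Z$ with $h(0,x)=x$, $h(1,x)\in B$ for all $x\in A$, and $h(s,Y)\subset Y$ for all $s\in I$. For closed $Y\subset A\subset Z$, $\mathrm{cat}_{Z,Y}(A)$ is the least $m\in\{0,1,2,\dots\}\cup\{\infty\}$ such that there are closed subsets $A_0,\dots,A_m$ of $Z$ with $A=\bigcup_{j=0}^mA_j$,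 $A_1,\dots,A_m$ contractible in $Z$, and $A_0\prec_YY$ in $Z$ ($\infty$ if no finite $m$ works). In $\mathrm{cat}_{N/E,[E]}$ the symbol $[E]$ stands for the closed set $\{[E]\}$. ''At least $\infty$'' means infinitely many. ANE: a metric space $Z$ is an absolute neighborhood extensor (ANE) if for every metric space $S$, every closed $F\subset S$ and every continuous $f:F\to Z$, there is a continuous extension of $f$ to a neighborhood of $F$ in $S$. Subsets of $X$ carry the induced metric. *)

(* Defs.v *)
From HB Require Import structures.
From mathcomp Require Import all_boot all_order all_algebra.
From mathcomp Require Import all_classical all_reals all_analysis.

Set Implicit Arguments.
Unset Strict Implicit.
Unset Printing Implicit Defensive.

Import Order.TTheory GRing.Theory Num.Theory.
Import numFieldNormedType.Exports.

Local Open Scope classical_set_scope.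
Local Open Scope ring_scope.

(* The induced metric on a subset, over the pseudometric structure that
   [set_type] already carries. *)
Section subset_metric.
Context {R : realType} {X : metricType R} (A : set X).

Let subset_mdist (x y : A) : R := mdist (set_val x) (set_val y).

Let subset_mdist_ge0 (x y : A) : 0 <= subset_mdist x y.
Proof. exact: mdist_ge0. Qed.

Let subset_mdist_positivity (x y : A) : subset_mdist x y = 0 -> x = y.
Proof. by move=> /mdist_positivity /val_inj. Qed.

Let subset_ballEmdist (x : A) (d : R) :
  ball x d = [set y | subset_mdist x y < d].
Proof. by rewrite -initial_ballE ballEmdist. Qed.

HB.instance Definition _ := PseudoMetric_isMetric.Build R (set_type A)
  subset_mdist_ge0 subset_mdist_positivity subset_ballEmdist.

End subset_metric.

(* Not [completeType], which would force the space to be nonempty. *)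
Definition complete_space {R : realType} (X : metricType R) : Prop :=
  forall u : nat -> X, cauchy (u @ \oo) -> exists l : X, u @ \oo --> l.

(* The total functions f and g stand for maps defined on F and on U only;
   their values elsewhere are irrelevant. *)
Definition ANE {R : realType} (Z : metricType R) : Prop :=
  forall (S : metricType R) (F : set S) (f : S -> Z),
    closed F -> {within F, continuous f} ->
    exists (U : set S) (g : S -> Z),
      [/\ F `<=` interior U, {within U, continuous g} &
          forall x, F x -> g x = f x].

Section semiflow.
Context {R : realType}.

Definition semiflow_domain (X : Type) (T : X -> \bar R) : set (R * X) :=
  [set p | 0 <= p.1 /\ (p.1%:E < T p.2)%E].

(* [sf_map t x] is meaningful only for (t, x) in the domain; every definition
   below evaluates it there only. In [sf_comp], that the right-hand side is
   defined is part of the semigroup law. *)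
Record local_semiflow (X : topologicalType) := LocalSemiflow {
  sf_time : X -> \bar R ;
  sf_map :> R -> X -> X ;
  sf_time_gt0 : forall x, (0 < sf_time x)%E ;
  sf_open : exists2 U : set (R * X), open U &
    semiflow_domain sf_time = U `&` [set p | 0 <= p.1] ;
  sf_continuous : {within semiflow_domain sf_time,
    continuous (fun p : R * X => sf_map p.1 p.2)} ;
  sf_map0 : forall x, sf_map 0 x = x ;
  sf_comp : forall (t s : R) (x : X), 0 <= t -> 0 <= s -> ((t + s)%:E < sf_time x)%E ->
    (t%:E < sf_time (sf_map s x))%E /\
    sf_map (t + s) x = sf_map t (sf_map s x)
}.

Context {X : topologicalType} (Phi : local_semiflow X).
Implicit Types (N E A : set X) (x : X) (s t : R).

Definition equilibrium x : Prop :=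
  sf_time Phi x = +oo%E /\ forall t, 0 <= t -> Phi t x = x.

Definition gradient : Prop :=
  exists V : X -> R,
    [/\ continuous V,
        forall (x : X) (s t : R), 0 <= s -> s <= t -> (t%:E < sf_time Phi x)%E ->
          V (Phi t x) <= V (Phi s x) &
        forall x, sf_time Phi x = +oo%E ->
          (forall t, 0 <= t -> V (Phi t x) = V x) -> equilibrium x].

(* Phi([0, t]) x is defined and contained in A. *)
Definition stays A t x : Prop :=
  (t%:E < sf_time Phi x)%E /\ forall s, 0 <= s -> s <= t -> A (Phi s x).

Definition exit_time N x : \bar R :=
  ereal_inf [set t%:E | t in [set t : R |
    0 <= t /\ ((sf_time Phi x <= t%:E)%E \/ ~ N (Phi t x))]].

Definition positively_invariant N E : Prop :=
  forall x t, N x -> E x -> 0 <= t -> stays N t x -> stays E t x.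

Definition exit_set N E : Prop :=
  positively_invariant N E /\
  forall x, N x -> (exit_time N x < sf_time Phi x)%E ->
    exists t, [/\ 0 <= t, (t%:E <= exit_time N x)%E & E (Phi t x)].

Definition admissible A : Prop :=
  forall (x : nat -> X) (t : nat -> R),
    (forall n, A (x n)) -> (forall n, 0 <= t n) ->
    t n @[n --> \oo] --> +oo ->
    (forall n, stays A (t n) (x n)) ->
    exists2 k : nat -> nat, {homo k : m n / (m < n)%N} &
      exists l : X, Phi (t (k n)) (x (k n)) @[n --> \oo] --> l.

Definition strongly_admissible A : Prop :=
  admissible A /\
  forall x, (forall t, 0 <= t -> (t%:E < sf_time Phi x)%E -> A (Phi t x)) ->
    sf_time Phi x = +oo%E.

Definition wazewski_pair N E : Prop :=
  [/\ closed N, closed E, exit_set N E &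
      strongly_admissible (closure (N `\` E))].

Definition transversal_pair N E : Prop :=
  let H := closure (N `\` E) in
  forall x t, (H `&` E) x -> 0 < t ->
    exists s : R, [/\ 0 < s, s < t, (s%:E < sf_time Phi x)%E &
                  ~ (H `&` E) (Phi s x)].

End semiflow.

Arguments local_semiflow R X : clear implicits.

(* The quotient Z/A has underlying set (Z \ A) + {[A]}, with [A] = None, and
   the final topology for the projection Z -> Z/A. If A is nonempty the
   projection is onto and this is the quotient topology; if A is empty, [A] is
   not in its image, so that {[A]} is open and Z/A is the topological sum of Z
   and a point. *)
Definition quot {Z : Type} (A : set Z) : Type := option (~` A).

Definition quot_pt {Z : Type} (A : set Z) : quot A := None.

Definition quot_proj {Z : Type} (A : set Z) (z : Z) : quot A := insub z.

Section quotient_space.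
Context {Z : topologicalType} (A : set Z).

HB.instance Definition _ := Choice.copy (quot A) (option (~` A)).

Let quot_open (U : set (quot A)) : Prop := open (quot_proj A @^-1` U).

Let quot_openT : quot_open setT.
Proof. exact: openT. Qed.

Let quot_openI : setI_closed quot_open.
Proof. by move=> U V oU oV; exact: openI. Qed.

Let quot_open_bigcup (I : Type) (f : I -> set (quot A)) :
  (forall i, quot_open (f i)) -> quot_open (\bigcup_i f i).
Proof. by move=> fo; apply: bigcup_open => i _; exact: fo. Qed.

HB.instance Definition _ := isOpenTopological.Build (quot A)
  quot_openT quot_openI quot_open_bigcup.

Lemma quot_openE (U : set (quot A)) : open U = open (quot_proj A @^-1` U).
Proof. by []. Qed.

Lemma quot_proj_in (z : Z) : A z -> quot_proj A z = quot_pt A.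
Proof. by move=> Az; apply: insubN; rewrite in_setC negbK; exact/mem_set. Qed.

Lemma quot_projP (y z : Z) :
  quot_proj A y = quot_proj A z <-> y = z \/ (A y /\ A z).
Proof.
split=> [|[->//|[Ay Az]]]; last by rewrite !quot_proj_in.
rewrite /quot_proj; case: insubP => [u _ <-|]; case: insubP => [v _ <-|] //.
- by move=> [->]; left.
- by rewrite !in_setC !negbK => /set_mem ? /set_mem ?; right.
Qed.

Lemma quot_pt_isolated : A = set0 -> open [set quot_pt A].
Proof.
move=> A0; rewrite quot_openE (_ : _ @^-1` _ = set0); first exact: open0.
rewrite -subset0 => z /=; rewrite /quot_proj /quot_pt.
by case: insubP => //; rewrite in_setC negbK => /set_mem; rewrite {1}A0.
Qed.

End quotient_space.

Section relative_category.
Variable R : realType.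
Context {Z : topologicalType}.
Implicit Types A B Y : set Z.

(* A homotopy I x A -> Z is a function on R * Z considered on [0, 1] x A only. *)
Definition contractible_in A : Prop :=
  exists h : R * Z -> Z,
    [/\ {within `[0, 1]%classic `*` A, continuous h},
        forall u, A u -> h (0, u) = u &
        forall u v, A u -> A v -> h (1, u) = h (1, v)].

(* A is deformed into B in Z, keeping Y in Y: A \prec_Y B. *)
Definition deformable Y A B : Prop :=
  Y `<=` A `&` B /\
  exists h : R * Z -> Z,
    [/\ {within `[0, 1]%classic `*` A, continuous h},
        forall x, A x -> h (0, x) = x,
        forall x, A x -> B (h (1, x)) &
        forall (s : R) (y : Z), 0 <= s <= 1 -> Y y -> Y (h (s, y))].

Definition relcat_cover Y A (m : nat) : Prop :=
  exists F : nat -> set Z,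
    [/\ forall j, (j <= m)%N -> closed (F j),
        A = \bigcup_(j in [set j | (j <= m)%N]) F j,
        forall j, (1 <= j <= m)%N -> contractible_in (F j) &
        deformable Y (F 0%N) Y].

(* cat_{Z,Y}(A), where None stands for infinity. *)
Definition relcat Y A : option nat :=
  if pselect (exists m, `[< relcat_cover Y A m >]) is left h
  then Some (ex_minn h) else None.

End relative_category.

Definition at_least {T : Type} (S : set T) (k : option nat) : Prop :=
  if k is Some m then (`I_m #<= S)%card else infinite_set S.

(* Main.v *)
Require Import Defs.
From HB Require Import structures.
From mathcomp Require Import all_boot all_order all_algebra.
From mathcomp Require Import all_classical all_reals all_analysis.
From mathcomp Require Import lra.

(* Transversality makes the entrance time into [E] continuous on [N], so that
   stopping the semiflow upon entering [E] gives a global continuous semiflow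
   [Psi] on [N] which fixes [E] pointwise. Suppose that [N \ E] contains finitely
   many equilibria, sorted by decreasing value of the Lyapunov function [V], and
   choose pairwise separated small balls [B_e] around them, contractible in [N]
   because [N] is an ANE. A trajectory that leaves [B_e] at a late time and later
   returns arbitrarily close to [e] would produce, by admissibility, a point of
   constant [V], hence an equilibrium, on the boundary of [B_e]. So there are
   times [T] and [tau e] such that every [x] in [N] satisfies [Psi T x \in E] or
   [Psi (tau e) x \in B_e] for some [e]. The preimages of [E] and of the balls
   under these time maps are the required closed cover: the semiflow itself
   deforms the first into [E] rel [E], and carries each of the others into [B_e],
   where it is contracted. The cover descends to [N/E], because the first
   homotopy fixes [E] pointwise and the other sets do not meet [E]. *)

Set Implicit Arguments.
Unset Strict Implicit.
Unset Printing Implicit Defensive.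

Import Order.TTheory GRing.Theory Num.Theory.
Import numFieldNormedType.Exports.

Local Open Scope classical_set_scope.
Local Open Scope ring_scope.

(** * Small balls in an ANE *)

Section product_metric.
Context {R : realType} {U V : metricType R}.

(** [ANE] quantifies over metric spaces, so using it on [R * Z] requires a metric there. The maximum
    metric has the balls that the product already carries. *)
Let prod_mdist (x y : U * V) : R := Num.max (mdist x.1 y.1) (mdist x.2 y.2).

Let prod_mdist_ge0 x y : 0 <= prod_mdist x y.
Proof. by rewrite le_max mdist_ge0. Qed.

Let prod_mdist_positivity x y : prod_mdist x y = 0 -> x = y.
Proof.
move=> xy0; have : prod_mdist x y <= 0 by rewrite xy0.
rewrite ge_max => /andP[x1 x2].
case: x y {xy0} x1 x2 => [x1 x2] [y1 y2] /= le1 le2.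
by congr pair; apply: mdist_positivity; apply/eqP; rewrite eq_le mdist_ge0 andbT.
Qed.

Let prod_ballEmdist (x : U * V) (d : R) : ball x d = [set y | prod_mdist x y < d].
Proof.
by apply/seteqP; split=> y; rewrite /ball /= /prod_ball !ballEmdist /prod_mdist /= gt_max => /andP.
Qed.

HB.instance Definition _ := PseudoMetric_isMetric.Build R (U * V)%type
  prod_mdist_ge0 prod_mdist_positivity prod_ballEmdist.

End product_metric.

Lemma fst_continuous {S T : topologicalType} : continuous (@fst S T).
Proof. by move=> p; exact: cvg_fst. Qed.

Lemma snd_continuous {S T : topologicalType} : continuous (@snd S T).
Proof. by move=> p; exact: cvg_snd. Qed.

Lemma closed_preimage {S T : topologicalType} (f : S -> T) (A : set T) :
  continuous f -> closed A -> closed (f @^-1` A).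
Proof. by move=> /continuous_closedP; exact. Qed.

Lemma within_continuous_eq {S T : topologicalType} (A : set S) (f g : S -> T) :
  (forall x, A x -> g x = f x) -> {within A, continuous g} -> {within A, continuous f}.
Proof.
by move=> gf; apply: subspace_eq_continuous => x /set_mem; exact: gf.
Qed.

(** Tube lemma, by compactness of the segment [[0, b]]. *)
Lemma near_segment {R : realType} {T : topologicalType} (P : R * T -> Prop) (b : R) (x : T) :
  (forall s, 0 <= s <= b -> \forall p \near (s, x), P p) ->
  \forall y \near x, forall s, 0 <= s <= b -> P (s, y).
Proof.
move=> H.
have /compact_near_coveringP/(_ T (nbhs x) (fun y s => P (s, y))) := @segment_compact R 0 b.
apply => s; rewrite /= in_itv /= => /H [[A B] /= [As Bx] AB].
by exists (A, B) => // -[s' y] AB'; exact: (AB (s', y)).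
Qed.

(* Extend the map equal to [z] for [t <= 0] and to [x0] for [t >= 1] or [z = x0]
   to a neighborhood of its closed domain in [R x Z]; this neighborhood contains
   [0, 1] x (a ball about [x0]). *)
Lemma ANE_contractible_ball {R : realType} (Z : metricType R) (x0 : Z) : ANE Z ->
  exists2 r : R, 0 < r & contractible_in R [set x | mdist x0 x <= r].
Proof.
move=> aneZ.
pose S : metricType R := (R^o * Z)%type.
pose F0 := [set p : R * Z | p.1 <= 0].
pose F1 := [set p : R * Z | 1 <= p.1] `|` [set p | p.2 = x0].
have cF0 : closed F0.
  apply: (@closed_preimage _ _ fst [set t : R | t <= 0]); first exact: fst_continuous.
  exact: closed_le.
have cF1 : closed F1.
  apply: closedU.
    apply: (@closed_preimage _ _ fst [set t : R | 1 <= t]); first exact: fst_continuous.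
    exact: closed_ge.
  apply: (@closed_preimage _ _ snd [set x0]); first exact: snd_continuous.
  exact: accessible_closed_set1 (hausdorff_accessible (@metric_hausdorff R Z)) x0.
pose f (p : R * Z) : Z := if p.1 <= 0 then p.2 else x0.
have [] := aneZ S (F0 `|` F1) f.
- exact: closedU.
- apply: withinU_continuous => //.
    apply: (@within_continuous_eq _ _ _ _ snd).
      by move=> p p0; rewrite /f ifT.
    by apply: continuous_subspaceT; exact: snd_continuous.
  apply: (@within_continuous_eq _ _ _ _ (fun=> x0)).
    move=> p pF; rewrite /f; case: ifP => // p0.
    case: pF => [/= /le_trans /(_ p0)|]; last by move=> ->.
    by rewrite ler10.
  by apply: continuous_subspaceT => p; exact: cvg_cst.
move=> U [g [FU gU gf]].
have : \forall y \near x0, forall s : R, 0 <= s <= 1 -> U (s, y).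
  apply: near_segment => s _; apply: FU.
  by right; right.
move=> /nbhs_ballP[r /= r0 rU].
(* Half the radius, so that the closed ball lies in the open one. *)
have r20 : 0 < r / 2 by rewrite divr_gt0.
exists (r / 2) => //; exists g; split.
- apply: (continuous_subspaceW _ gU) => -[s y] [/= + yr]; rewrite in_itv /= => s01.
  apply: rU s01; rewrite ballEmdist /= (le_lt_trans yr)//.
  by rewrite ltr_pdivrMr// ltr_pMr// ltr1n.
- by move=> u ur; rewrite gf /f /= ?lexx//; left; exact: lexx.
- have g1 u : g (1, u) = x0 by rewrite gf /f /= ?ler10//; right; left; exact: lexx.
  by move=> u v _ _; rewrite !g1.
Qed.

Lemma mdist_continuous {R : realType} {Z : metricType R} (c : Z) :
  continuous (fun x : Z => mdist c x : R).
Proof.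
move=> x; apply/cvgrPdist_lt => e e0.
have : nbhs x (ball x e) by exact: nbhsx_ballx.
apply: filterS => y; rewrite ballEmdist /= => xy.
have := metric_triangle c x y; have := metric_triangle c y x.
rewrite (metric_sym y x) => h1 h2.
rewrite ltr_norml; apply/andP; split; lra.
Qed.

(** * Gradient semiflows with an absorbing exit set *)

Lemma cvg_subsequence (k : nat -> nat) :
  (forall n, (n <= k n)%N) -> k @ \oo --> \oo.
Proof.
move=> kn P [n _ Pn]; exists n => // m nm; apply: Pn => /=.
exact: leq_trans nm (kn m).
Qed.

(** The properties of the stopped semiflow on which the covering argument rests. Continuity ranges
    over all of [R] since negative times will act as 0. [gs_absorb] is what is kept of the
    continuity of the entrance time, and [gs_compact] of admissibility. [gs_Vcst] has to exclude
    [E], all of whose points are fixed by stopping. *)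
Record gradient_semiflow {R : realType} {Z : metricType R}
    (Psi : R -> Z -> Z) (E K : set Z) (V : Z -> R) : Prop := GradientSemiflow {
  gs_continuous : continuous (fun p : R * Z => Psi p.1 p.2);
  gs_map0 : forall x, Psi 0 x = x;
  gs_add : forall (s t : R) (x : Z), 0 <= s -> 0 <= t -> Psi (s + t) x = Psi s (Psi t x);
  gs_closed : closed E;
  gs_exit : forall (t : R) (x : Z), E x -> Psi t x = x;
  gs_absorb : forall x, E x -> exists2 t : R, 0 <= t & \forall y \near x, E (Psi t y);
  gs_Vcontinuous : continuous V;
  gs_Vle : forall (t : R) (x : Z), 0 <= t -> V (Psi t x) <= V x;
  gs_restE : forall x, K x -> ~ E x;
  gs_rest : forall (t : R) (x : Z), K x -> 0 <= t -> Psi t x = x;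
  gs_Vcst : forall x, (forall t : R, 0 <= t -> ~ E (Psi t x)) ->
    (forall t : R, 0 <= t -> V (Psi t x) = V x) -> K x;
  gs_compact : forall (x : nat -> Z) (t : nat -> R),
    (forall n, n%:R <= t n) -> (forall n, ~ E (Psi (t n) (x n))) ->
    exists2 k : nat -> nat, forall n, (n <= k n)%N &
      exists l : Z, Psi (t (k n)) (x (k n)) @[n --> \oo] --> l }.

Arguments gs_continuous {R Z Psi E K V} _ _.
Arguments gs_Vcontinuous {R Z Psi E K V} _ _.
Arguments gs_compact {R Z Psi E K V} _ _ _ _ _.

Section gradient_semiflow_theory.
Context {R : realType} {Z : metricType R}.
Context {Psi : R -> Z -> Z} {E K : set Z} {V : Z -> R}.
Context (gs : gradient_semiflow Psi E K V).

Lemma gs_cvg {T : Type} {F : set_system T} {FF : Filter F} (s : R) (y : T -> Z) l :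
  y @ F --> l -> (fun u => Psi s (y u)) @ F --> Psi s l.
Proof.
move=> yl.
apply: (@continuous2_cvg _ _ _ _ _ FF (fun=> s) y Psi s l) => //.
- exact: (gs_continuous gs (s, l)).
- exact: cvg_cst.
Qed.

Arguments gs_cvg {T F FF} s {y l} _.

Lemma gs_Vcvg {T : Type} {F : set_system T} {FF : Filter F} (y : T -> Z) l :
  y @ F --> l -> (fun u => V (y u)) @ F --> V l.
Proof. exact: (continuous_cvg _ (gs_Vcontinuous gs l)). Qed.

Lemma gs_orbit_continuous x : continuous (Psi ^~ x).
Proof.
move=> s; apply: (@continuous2_cvg _ _ _ _ _ _ id (fun=> x) Psi s x).
- exact: (gs_continuous gs (s, x)).
- exact: cvg_id.
- exact: cvg_cst.
Qed.

Lemma gs_Vmono x s t : 0 <= s -> s <= t -> V (Psi t x) <= V (Psi s x).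
Proof.
move=> s0 st; rewrite -(subrK s t) (gs_add gs) ?subr_ge0//.
by apply: (gs_Vle gs); rewrite subr_ge0.
Qed.

Lemma gs_exit_mono x s t : 0 <= s -> s <= t -> E (Psi s x) -> E (Psi t x).
Proof.
by move=> s0 st Es; rewrite -(subrK s t) (gs_add gs) ?subr_ge0// (gs_exit gs).
Qed.

(** Absorption at [Psi t l] brings the nearby points [Psi t (y n)] into [E] within one more common
    time. *)
Lemma gs_limit_exit (y : nat -> Z) l (t : R) : y @ \oo --> l -> 0 <= t ->
  E (Psi t l) -> exists2 s, 0 <= s & \forall n \near \oo, E (Psi s (y n)).
Proof.
move=> yl t0 /(gs_absorb gs)[s s0 sE]; exists (s + t); first exact: addr_ge0.
have : \forall n \near \oo, E (Psi s (Psi t (y n))) by exact: (gs_cvg t yl) sE.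
by apply: filterS => n; rewrite -(gs_add gs).
Qed.

(** If the trajectory of [l] entered [E], those of all but finitely many [y n] would be in [E] from
    a common time on. *)
Lemma gs_limit_no_exit (y : nat -> Z) l : y @ \oo --> l ->
  (forall n, exists2 u : R, n%:R <= u & ~ E (Psi u (y n))) ->
  forall t : R, 0 <= t -> ~ E (Psi t l).
Proof.
move=> yl yE t t0 /(gs_limit_exit yl t0)[s s0 sE].
have [n [En sn]] := @filter_ex _ _ _ _ (filterI sE (nbhs_infty_ger s)).
by have [u nu] := yE n; apply; apply: (@gs_exit_mono _ s) => //; exact: le_trans nu.
Qed.

Lemma gs_limit_avoid (W : set Z) (y : nat -> Z) l : open W -> y @ \oo --> l ->
  (forall n (t : R), 0 <= t -> ~ W (Psi t (y n))) ->
  forall t : R, 0 <= t -> ~ W (Psi t l).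
Proof.
move=> oW yl yW t t0; apply: (closed_cvg (~` W) _ _ _ (gs_cvg t yl)).
  exact: open_closedC.
by apply: nearW => n; exact: yW.
Qed.

(* LaSalle: a trajectory that never exits accumulates at a rest point. *)
Lemma gs_omega x : (forall t, 0 <= t -> ~ E (Psi t x)) ->
  exists e, [/\ K e, forall t, 0 <= t -> V e <= V (Psi t x) &
    exists2 u : nat -> R, forall n, n%:R <= u n &
      (fun n => Psi (u n) x) @ \oo --> e].
Proof.
move=> xE.
have [k kn [e xe]] := gs_compact gs (fun=> x) (fun n => n%:R)
  (fun=> lexx _) (fun n => xE _ (ler0n _ _)).
have kR n : n%:R <= (k n)%:R :> R by rewrite ler_nat.
have Ve t : 0 <= t -> V e <= V (Psi t x).
  move=> t0; apply: (closed_cvg _ (@closed_le _ (V (Psi t x))) _ _ (gs_Vcvg xe)).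
  have := nbhs_infty_ger t; apply: filterS => n tn.
  by apply: gs_Vmono => //; exact: le_trans tn _.
exists e; split=> //; last by exists (fun n => (k n)%:R).
apply: (gs_Vcst gs) => [t t0|t t0].
  apply: (gs_limit_no_exit xe) => // n; exists n%:R => //.
  by rewrite -(gs_add gs)//; apply: xE; rewrite addr_ge0.
apply/eqP; rewrite eq_le (gs_Vle gs)//=.
(* [Psi t e] is a limit of positions on the trajectory of [x], along which [V] is at least [V e]. *)
apply: (closed_cvg _ (@closed_ge _ (V e)) _ _ (gs_Vcvg (gs_cvg t xe))).
apply: nearW => n; rewrite -(gs_add gs)//; apply: Ve; exact: addr_ge0.
Qed.

(** Otherwise some [x n] avoid [W] and are outside [E] at time [n + n]. A limit [y] of their
    positions at time [n] never exits, because the time left is unbounded, and it leads to a rest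
    point outside [W], although [W] contains [K]. *)
Lemma gs_uniform_exit (W : set Z) : open W -> K `<=` W ->
  exists2 T, 0 <= T & forall x, (forall t, 0 <= t -> ~ W (Psi t x)) -> E (Psi T x).
Proof.
move=> oW KW; apply: contrapT => H.
have /choice[x xP] : forall n : nat, exists x,
    (forall t, 0 <= t -> ~ W (Psi t x)) /\ ~ E (Psi (n%:R + n%:R) x).
  move=> n; apply: contrapT => Hn; apply: H; exists (n%:R + n%:R); first exact: addr_ge0.
  by move=> x xW; apply: contrapT => xE; apply: Hn; exists x.
have [n|k kn [y xy]] := gs_compact gs x (fun n => n%:R) (fun=> lexx _).
  move=> /gs_exit_mono H'; case: (xP n) => _; apply; apply: H' => //.
  by rewrite lerDl.
have yE t : 0 <= t -> ~ E (Psi t y).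
  apply: (gs_limit_no_exit xy) => n; exists (k n)%:R; first by rewrite ler_nat.
  by rewrite -(gs_add gs)//; case: (xP (k n)).
have [e [/KW We _ [u un ue]]] := gs_omega yE.
suff : (~` W) e by exact.
apply: (closed_cvg _ (open_closedC oW) _ _ ue); apply: nearW => n.
apply: (gs_limit_avoid oW xy) => [m t t0|]; last exact: le_trans (un n).
by rewrite -(gs_add gs)//; apply: (xP (k m)).1; rewrite addr_ge0.
Qed.

(* Otherwise there are trajectories that are outside the [r]-ball about [e] at
   time [2n] and later come arbitrarily close to [e]. Their crossings of the
   sphere of radius [r] accumulate at some [p]. Every value of [V] along [p] is at
   least [V e], since [p] leads to [e]; and [V p <= V e], since [p] comes after
   the limit [w] of the positions at time [n], whose own limit rest point is not
   in [W]. So [V] is constant along [p], and [p] is a rest point. *)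
Lemma gs_leave (e : Z) (W : set Z) (r : R) : K e -> open W -> 0 < r ->
  (forall x, K x -> W x \/ V x <= V e) ->
  (forall x, K x -> mdist e x != r) ->
  (forall x, mdist e x <= r -> ~ E x) ->
  exists T d, [/\ 0 <= T, 0 < d & forall x, (forall t, 0 <= t -> ~ W (Psi t x)) ->
    mdist e (Psi T x) <= r \/ forall t, 0 <= t -> ~ ball e d (Psi t (Psi T x))].
Proof.
move=> Ke oW r0 KW Kr rE; apply: contrapT => H.
have /choice[x /all_and2[xW xP]] : forall n : nat, exists x,
    (forall t, 0 <= t -> ~ W (Psi t x)) /\
    exists a b, [/\ n%:R + n%:R <= a, a <= b, mdist e (Psi a x) = r &
      mdist e (Psi b x) < r / n.+1%:R].
  move=> n; apply: contrapT => Hn; apply: H.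
  have nn0 : 0 <= n%:R + n%:R :> R by rewrite addr_ge0.
  exists (n%:R + n%:R), (r / n.+1%:R); split => //; first by rewrite divr_gt0.
  move=> x xW; have [|xr] := leP (mdist e (Psi (n%:R + n%:R) x)) r; first by left.
  right => t t0 bt; apply: Hn; exists x; split => //.
  have bt' : mdist e (Psi (t + (n%:R + n%:R)) x) < r / n.+1%:R.
    by move: bt; rewrite -(gs_add gs)// ballEmdist.
  have [|||a] := @IVT R (fun s => mdist e (Psi s x)) (n%:R + n%:R)
      (t + (n%:R + n%:R)) r.
  - by rewrite lerDr.
  - apply: continuous_subspaceT => s.
    apply: (@continuous_comp _ _ _ (Psi ^~ x) (mdist e)).
      exact: gs_orbit_continuous.
    exact: mdist_continuous.
  - rewrite ge_min le_max (ltW xr) /= andbT; apply/orP; right.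
    apply: (le_trans (ltW bt')).
    by rewrite ler_pdivrMr// ler_peMr ?(ltW r0)// ler1n.
  rewrite in_itv /= => /andP[na ab] ar.
  by exists a, (t + (n%:R + n%:R)).
have /choice[a /choice[b abP]] := xP.
have na n : n%:R <= a n.
  by case: (abP n) => + _ _ _; apply: le_trans; rewrite lerDl.
have a0 n : 0 <= a n by exact: le_trans (na n).
have ab n : a n <= b n by case: (abP n).
have b0 n : 0 <= b n by exact: le_trans (ab n).
have ar n : mdist e (Psi (a n) (x n)) = r by case: (abP n).
have aE n : ~ E (Psi (a n) (x n)) by apply: rE; rewrite ar.
have be : Psi (b n) (x n) @[n --> \oo] --> e.
  apply/metricType_numDomainType.cvgrPdist_lt => eps eps0; have := nbhs_infty_ger (r / eps).
  apply: filterS => n rn; case: (abP n) => _ _ _ /lt_le_trans; apply.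
  rewrite ler_pdivrMr// mulrC -ler_pdivrMr//; apply: (le_trans rn).
  by rewrite ler_nat.
have [k1 k1n [w xw]] : exists2 k : nat -> nat, forall n, (n <= k n)%N &
      exists l : Z, Psi (k n)%:R (x (k n)) @[n --> \oo] --> l.
  apply: (gs_compact gs x (fun n => n%:R)) => // n.
  by move=> /gs_exit_mono En; apply: (aE n); exact: En.
have [n|n|k2 k2n [p xp]] := gs_compact gs (x \o k1) (a \o k1).
- by rewrite (le_trans _ (na _))// ler_nat.
- exact: aE.
pose k := k1 \o k2.
have kn n : (n <= k n)%N by exact: leq_trans (k2n n) (k1n _).
have koo : k @ \oo --> \oo by exact: cvg_subsequence.
have {}xw : Psi (k n)%:R (x (k n)) @[n --> \oo] --> w.
  apply: (cvg_comp k2 _ _ xw); exact: cvg_subsequence.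
have {}be : Psi (b (k n)) (x (k n)) @[n --> \oo] --> e.
  exact: (cvg_comp k _ koo be).
have {}xp : Psi (a (k n)) (x (k n)) @[n --> \oo] --> p by exact: xp.
have pr : mdist e p = r.
  have h : (fun n => mdist e (Psi (a (k n)) (x (k n))) : R) @ \oo --> (mdist e p : R).
    exact: (continuous_cvg _ (@mdist_continuous _ _ e p) xp).
  have : [set z : R | z = r] (mdist e p).
    apply: (closed_cvg [set z : R | z = r] _ _ _ h); first exact: closed_eq.
    by apply: nearW => n; exact: ar.
  by [].
(* If [p] exited, then after a common time [s] the later positions converging to [e] would
   eventually lie in [E]. As [E] is closed, so would [Psi s e], which is [e]. *)
have pE t : 0 <= t -> ~ E (Psi t p).
  move=> t0 /(gs_limit_exit xp t0)[s s0 sE]; apply: (gs_restE gs Ke).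
  rewrite -(gs_rest gs Ke s0).
  apply: (closed_cvg _ (gs_closed gs) _ _ (gs_cvg s be)); apply: filterS sE => n.
  rewrite -!(gs_add gs)//; apply: gs_exit_mono; first exact: addr_ge0.
  by rewrite lerD2l.
have Vpe t : 0 <= t -> V e <= V (Psi t p).
  move=> t0; rewrite -(gs_rest gs Ke t0).
  apply: (ler_cvg_to (gs_Vcvg (gs_cvg t be)) (gs_Vcvg (gs_cvg t xp))).
  apply: nearW => n; rewrite -!(gs_add gs)//; apply: gs_Vmono; first exact: addr_ge0.
  by rewrite lerD2l.
have aD n : (k n)%:R + (k n)%:R <= a (k n) by case: (abP (k n)).
(* At least [k n] units of time separate the positions tending to [w] from the crossings, which lie
   outside [E]. *)
have wE t : 0 <= t -> ~ E (Psi t w).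
  apply: (gs_limit_no_exit xw) => n; exists (a (k n) - (k n)%:R).
    by rewrite lerBrDr (le_trans _ (aD n))// lerD2r ler_nat.
  by rewrite -(gs_add gs) ?subr_ge0// subrK.
have Vpw t : 0 <= t -> V p <= V (Psi t w).
  move=> t0; apply: (ler_cvg_to (gs_Vcvg xp) (gs_Vcvg (gs_cvg t xw))).
  have := nbhs_infty_ger t; apply: filterS => n tn; rewrite -(gs_add gs)//.
  apply: gs_Vmono; first exact: addr_ge0.
  by rewrite (le_trans _ (aD n))// lerD2r (le_trans tn)// ler_nat.
have Vp : V p <= V e.
  have [f [Kf _ [u un uf]]] := gs_omega wE.
  have u0 n : 0 <= u n by exact: le_trans (un n).
  case: (KW f Kf) => [Wf|].
    suff : (~` W) f by exact.
    apply: (closed_cvg _ (open_closedC oW) _ _ uf); apply: nearW => n.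
    apply: (gs_limit_avoid oW xw) => // m t t0.
    by rewrite -(gs_add gs)//; apply: xW; exact: addr_ge0.
  apply: le_trans.
  apply: (closed_cvg _ (@closed_ge _ (V p)) _ _ (gs_Vcvg uf)).
  by apply: nearW => n; exact: Vpw.
(* A rest point on the sphere of radius [r] contradicts [Kr]. *)
suff /Kr : K p by rewrite pr eqxx.
apply: (gs_Vcst gs) => // t t0; apply/eqP; rewrite eq_le (gs_Vle gs)//=.
exact: le_trans Vp (Vpe _ _).
Qed.

(** Induction on [l], where the open set [W] holds the rest points already dealt with. The head [e]
    has the largest value of [V] in the list, so [gs_leave] applies: a trajectory is near [e] at
    time [T1] or avoids a neighborhood of [e] from then on. In the second case that neighborhood
    joins [W] and the induction hypothesis takes over from [Psi T1 x]. *)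
Lemma gs_cover_avoiding (r : Z -> R) (l : seq Z) (W : set Z) :
  (forall e, K e -> [/\ 0 < r e, forall x, K x -> mdist e x != r e &
    forall x, mdist e x <= r e -> ~ E x]) ->
  open W -> uniq l -> sorted (fun x y => V y <= V x) l ->
  (forall x, x \in l -> K x) -> (forall x, K x -> W x \/ x \in l) ->
  exists T (tau : Z -> R), [/\ 0 <= T, forall e, 0 <= tau e &
    forall x, (forall t, 0 <= t -> ~ W (Psi t x)) ->
      E (Psi T x) \/ exists2 e, e \in l & mdist e (Psi (tau e) x) <= r e].
Proof.
move=> rP; elim: l W => [|e l IH] W oW /=.
  move=> _ _ _ KW; have [|T T0 TE] := gs_uniform_exit oW.
    by move=> x /KW[].
  by exists T, (fun=> 0); split=> // x /TE; left.
move=> /andP[el ul] el_sorted lK KW.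
have Ke : K e by apply: lK; rewrite mem_head.
have [r0 Kr rE] := rP e Ke.
have le_e x : x \in l -> V x <= V e.
  have /allP : all (fun x => V x <= V e) l; last exact.
  by apply: (@order_path_min _ (fun x y => V y <= V x)) => // ? ? ? /[swap]; exact: le_trans.
have [|T1 [d [T10 d0 TP]]] := @gs_leave e W (r e) Ke oW r0 _ Kr rE.
  move=> x /KW[|]; first by left.
  by rewrite inE => /predU1P[->|/le_e]; right.
have [|||x xl|x /KW[|]|T [tau [T0 tau0 tauP]]] := IH (W `|` (ball e d)°).
- by apply: openU => //; exact: open_interior.
- by [].
- exact: path_sorted el_sorted.
- by apply: lK; rewrite inE xl orbT.
- by left; left.
- rewrite inE => /predU1P[->|]; last by right.
  by left; right; exact: nbhsx_ballx.
(* The times for the tail count from [T1], hence the shift. *)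
exists (T + T1), (fun x => if x == e then T1 else tau x + T1); split.
- exact: addr_ge0.
- by move=> x; case: ifP => // _; exact: addr_ge0.
move=> x xW; have [xe|xe] := TP x xW.
  by right; exists e; rewrite ?mem_head// eqxx.
have [|Ex|[f fl xf]] := tauP (Psi T1 x).
- move=> t t0 [|/interior_subset]; last exact: xe.
  by rewrite -(gs_add gs)//; apply: xW; exact: addr_ge0.
- by left; rewrite (gs_add gs).
right; exists f; first by rewrite inE fl orbT.
have /negbTE-> : f != e by apply: contraNneq el => <-.
by rewrite (gs_add gs).
Qed.

Lemma gs_cover (r : Z -> R) (l : seq Z) :
  (forall e, K e -> [/\ 0 < r e, forall x, K x -> mdist e x != r e &
    forall x, mdist e x <= r e -> ~ E x]) ->
  uniq l -> K = [set` l] ->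
  exists T (tau : Z -> R), [/\ 0 <= T, forall e, 0 <= tau e &
    forall x, E (Psi T x) \/ exists2 e, e \in l & mdist e (Psi (tau e) x) <= r e].
Proof.
move=> rP ul Kl; set leV := fun x y => V y <= V x.
(* With [W] empty every trajectory qualifies. *)
have [|||x|x|T [tau [T0 tau0 tauP]]] := @gs_cover_avoiding r (sort leV l) set0 rP.
- exact: open0.
- by rewrite sort_uniq.
- by apply: sort_sorted => x y; exact: le_total.
- by rewrite mem_sort Kl.
- by rewrite Kl mem_sort; right.
exists T, tau; split=> // x; have [t _ []|Ex|[e]] := tauP x; first by left.
by rewrite mem_sort; right; exists e.
Qed.

End gradient_semiflow_theory.

(** * Relative category and quotients *)

Lemma within_continuous_composition {S T U : topologicalType} (C : set S) (D : set T)
    (f : S -> T) (g : T -> U) :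
  {within C, continuous f} -> {within D, continuous g} -> f @` C `<=` D ->
  {within C, continuous (g \o f)}.
Proof.
move=> /subspace_continuousP cf /subspace_continuousP cg CD.
apply/subspace_continuousP => x Cx W /(cg _ (CD _ (imageP f Cx))) gW.
have := cf x Cx _ gW; rewrite !nbhs_simpl /=.
rewrite /within /=; apply: filterS => y + Cy => /(_ Cy); apply.
by apply: CD; exists y.
Qed.

Lemma continuous_at_within {S T : topologicalType} (A : set S) (f : S -> T) :
  (forall x, A x -> {for x, continuous f}) -> {within A, continuous f}.
Proof.
move=> cf; apply/subspace_continuousP => x Ax W /(cf x Ax) fW.
by move: fW; rewrite !nbhs_simpl /= /within /=; apply: filterS.
Qed.

Lemma pair_continuous {S T U : topologicalType} (f : S -> T) (g : S -> U) :
  continuous f -> continuous g -> continuous (fun x => (f x, g x)).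
Proof. by move=> cf cg x; apply: cvg_pair; [exact: cf|exact: cg]. Qed.

Lemma relcat_cover_seq {R : realType} {Z : topologicalType} {I : eqType}
    (Y F0 : set Z) (l : seq I) (B : I -> set Z) :
  closed F0 -> deformable R Y F0 Y ->
  (forall e, e \in l -> closed (B e) /\ contractible_in R (B e)) ->
  (forall x, F0 x \/ exists2 e, e \in l & B e x) ->
  relcat_cover R Y [set: Z] (size l).
Proof.
move=> cF0 dF0 lB cov.
(* Index 0 is the set deformed into [Y], and the sets of the list follow, shifted by one. The
   default [set0] is never reached up to index [size l]. *)
pose F j := if j is i.+1 then nth set0 (map B l) i else F0.
have FS i : (i < size l)%N -> exists2 e, e \in l & F i.+1 = B e.
  case: l @F {lB cov} => // e l F il; exists (nth e (e :: l) i); first exact: mem_nth.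
  by rewrite /F (nth_map e).
exists F; split=> //.
- by case=> [//|i /FS[e /lB[cB _] ->]].
- apply/esym/seteqP; split=> // x _; case: (cov x) => [F0x|[e el Bx]].
    by exists 0%N.
  exists (index e l).+1; first by rewrite /= index_mem.
  by rewrite /F (nth_map e) ?index_mem// nth_index.
- by case=> [//|i /andP[_] /FS[e /lB[_ cB] ->]].
Qed.

Lemma at_least_relcat {R : realType} {Z : topologicalType} {T : Type} (S : set T)
    (Y A : set Z) (m : nat) :
  relcat_cover R Y A m -> (`I_m #<= S)%card -> at_least S (relcat R Y A).
Proof.
move=> mc mS; rewrite /relcat; case: pselect => [h|[]]; last first.
  by exists m; apply/asboolP.
case: ex_minnP => k _ kmin /=; apply: card_le_trans mS.
by rewrite card_le_II; apply: kmin; apply/asboolP.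
Qed.

Lemma infinite_at_least {T : Type} (S : set T) k : infinite_set S -> at_least S k.
Proof.
move=> iS; case: k => [m|//] /=; move/infiniteP: iS; apply: card_le_trans.
exact: subset_card_le.
Qed.

(** * Homotopies along the flow *)

Section semiflow_homotopies.
Context {R : realType} {Z : topologicalType} (Psi : R -> Z -> Z).
Context (Psi_cont : continuous (fun p : R * Z => Psi p.1 p.2)).
Context (Psi0 : forall x, Psi 0 x = x).

Lemma flow_homotopy_continuous (f : R -> R) : continuous f ->
  continuous (fun p : R * Z => Psi (f p.1) p.2).
Proof.
move=> cf p.
apply: (@continuous_comp _ _ _ (fun p : R * Z => (f p.1, p.2))
  (fun p => Psi p.1 p.2)); last exact: Psi_cont.
apply: pair_continuous; last exact: snd_continuous.
move=> q; apply: (@continuous_comp _ _ _ fst f); [exact: fst_continuous|exact: cf].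
Qed.

Lemma flow_map_continuous T : continuous (Psi T).
Proof.
move=> x; apply: (@continuous_comp _ _ _ (fun x => (T, x)) (fun p => Psi p.1 p.2)).
  by apply: pair_continuous => ?; [exact: cvg_cst|exact: cvg_id].
exact: Psi_cont.
Qed.

Lemma scale_continuous (a b : R) : continuous (fun s : R => s * a + b).
Proof.
by move=> s; apply: cvgD; [apply: cvgMl; exact: cvg_id|exact: cvg_cst].
Qed.

(** Flow for time [T] during the first half of [[0, 1]], then contract [A] during the second. *)
Lemma contractible_flow_preimage (A : set Z) (T : R) : closed A ->
  contractible_in R A -> contractible_in R (Psi T @^-1` A).
Proof.
move=> cA [g [gcont g0 g1]].
have cP : closed (Psi T @^-1` A) by apply: closed_preimage => //; exact: flow_map_continuous.
(* The summand [+ 0] gives the time the affine form of [scale_continuous]. *)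
pose h (p : R * Z) := if p.1 <= 2^-1 then Psi (p.1 * (2 * T) + 0) p.2
  else g (p.1 * 2 + -1, Psi T p.2).
exists h; split.
- pose C := [set p : R * Z | p.1 <= 2^-1] `&` snd @^-1` (Psi T @^-1` A).
  pose D := ([set p : R * Z | 2^-1 <= p.1] `&` [set p : R * Z | p.1 <= 1])
    `&` snd @^-1` (Psi T @^-1` A).
  have cC (a : R) : closed [set p : R * Z | p.1 <= a].
    apply: (@closed_preimage _ _ fst [set t : R | t <= a]); first exact: fst_continuous.
    exact: closed_le.
  have cD (a : R) : closed [set p : R * Z | a <= p.1].
    apply: (@closed_preimage _ _ fst [set t : R | a <= t]); first exact: fst_continuous.
    exact: closed_ge.
  have cS : closed (@snd R Z @^-1` (Psi T @^-1` A)).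
    by apply: closed_preimage => //; exact: snd_continuous.
  apply: (@continuous_subspaceW _ _ _ (C `|` D)).
    move=> [s x] [/=]; rewrite in_itv /= => /andP[s0 s1] Ax.
    by have [s2|/ltW s2] := leP s 2^-1; [left|right].
  apply: withinU_continuous.
  + exact: closedI.
  + by apply: closedI => //; exact: closedI.
  + apply: (@within_continuous_eq _ _ _ _ (fun p : R * Z => Psi (p.1 * (2 * T) + 0) p.2)).
      by move=> p [p2 _]; rewrite /h p2.
    apply: continuous_subspaceT; apply: (@flow_homotopy_continuous (fun s : R => s * (2 * T) + 0)).
    exact: scale_continuous.
  + apply: (@within_continuous_eq _ _ _ _ (g \o fun p : R * Z => (p.1 * 2 + -1, Psi T p.2))).
      move=> p [[p2 _] Ap]; rewrite /h; case: ifP => //= p2'.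
      (* At parameter 1/2 both formulas give [Psi T], since [g] starts at the identity. *)
      have -> : p.1 = 2^-1 by apply/eqP; rewrite eq_le p2' p2.
      by rewrite mulVf// addrN g0// mulrA mulVf// mul1r addr0.
    apply: within_continuous_composition gcont _.
      apply: continuous_subspaceT; apply: pair_continuous => p.
        apply: (@continuous_comp _ _ _ fst (fun s : R => s * 2 + -1)).
          exact: fst_continuous.
        exact: scale_continuous.
      apply: (@continuous_comp _ _ _ snd (Psi T)); first exact: snd_continuous.
      exact: flow_map_continuous.
    move=> _ [p [[/= p2 p1] Ap] <-]; split=> //=; rewrite in_itv /=.
    by apply/andP; split; lra.
- by move=> u _; rewrite /h /= invr_ge0 ler0n mul0r addr0 Psi0.
- move=> u v Au Av; rewrite /h /= ifF; last by apply/negbTE; rewrite -ltNge; lra.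
  rewrite mul1r ifF; last by apply/negbTE; rewrite -ltNge; lra.
  have -> : 2 + -1 = 1 :> R by lra.
  exact: g1.
Qed.

Lemma deformable_exit (E : set Z) (T : R) : (forall t x, E x -> Psi t x = x) ->
  deformable R E (Psi T @^-1` E) E.
Proof.
move=> PE; split; first by move=> x Ex; split=> //=; rewrite PE.
exists (fun p => Psi (p.1 * T + 0) p.2); split=> [|x _|x|s y _ Ey] /=.
- apply: continuous_subspaceT; apply: (@flow_homotopy_continuous (fun s : R => s * T + 0)).
  exact: scale_continuous.
- by rewrite mul0r addr0 Psi0.
- by rewrite mul1r addr0.
- by rewrite PE.
Qed.

End semiflow_homotopies.

(** * Homotopies on the quotient *)

Section quotient_homotopies.
Context {R : realType} {Z : topologicalType} (E : set Z).
Context (cE : closed E).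

Lemma quot_proj_continuous : continuous (quot_proj E).
Proof. by apply/continuousP => U; rewrite quot_openE. Qed.

Lemma quot_closed (C : set (quot E)) : closed (quot_proj E @^-1` C) -> closed C.
Proof. by rewrite -!openC quot_openE. Qed.

Lemma quot_projK (u : ~` E) : quot_proj E (set_val u) = Some u.
Proof. exact: valK. Qed.

Lemma quot_proj_out z : ~ E z -> exists2 u : ~` E, quot_proj E z = Some u & set_val u = z.
Proof.
move=> Ez; rewrite /quot_proj; case: insubP => [u _ uz|]; first by exists u.
by rewrite in_setC negbK => /set_mem.
Qed.

(** [E] is closed, so the projection is an open embedding off [E]. *)
Lemma quot_nbhs_Some (u : ~` E) (W : set Z) : nbhs (set_val u) W ->
  nbhs (Some u : quot E) [set q | if q is Some v then W (set_val v) else False].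
Proof.
rewrite nbhsE => -[Q [oQ Qu] QW].
apply: (@filterS _ _ _ [set q : quot E | if q is Some v then Q (set_val v) else False]).
  by case=> // v; exact: QW.
apply: open_nbhs_nbhs; split=> //; rewrite quot_openE.
rewrite (_ : _ @^-1` _ = Q `&` ~` E); first by apply: (openI oQ); rewrite openC.
apply/seteqP; split=> z /=.
  have [Ez|/quot_proj_out[v -> <-] Qv] := pselect (E z); first by rewrite quot_proj_in.
  by split=> //; exact: (set_valP v).
by case=> Qz /quot_proj_out[v -> vz]; rewrite vz.
Qed.

(** A set disjoint from [E] is saturated for the projection. *)
Lemma quot_image_closed (A : set Z) : closed A -> A `&` E = set0 ->
  closed (quot_proj E @` A).
Proof.
move=> cA AE; apply: quot_closed.
rewrite (_ : _ @^-1` _ = A) //; apply/seteqP; split=> [z [a Aa]|z Az]; last by exists z.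
move/quot_projP => [<- //|[Ea _]].
by have : (A `&` E) a by []; rewrite AE.
Qed.

(** The image of [A] is lifted back to [A] by a section, continuous because [A] misses [E]. The
    contraction [g] is applied there and projected, so it may cross [E] freely. *)
Lemma contractible_quot_image (A : set Z) : A `&` E = set0 ->
  contractible_in R A -> contractible_in R (quot_proj E @` A).
Proof.
move=> AE [g [gcont g0 g1]].
have AE' a : A a -> ~ E a by move=> Aa Ea; have : (A `&` E) a by []; rewrite AE.
have [A0|/set0P[a0 Aa0]] := eqVneq A set0.
  exists snd; split; first by apply: continuous_subspaceT; exact: snd_continuous.
    by [].
  by move=> u v [a]; rewrite A0.
(* [a0] is an arbitrary value at the collapsed point, which the image of [A] misses. *)
pose sec (q : quot E) := if q is Some u then set_val u else a0.
have secK a : A a -> sec (quot_proj E a) = a.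
  by move=> Aa; have [u qu ua] := quot_proj_out (AE' a Aa); rewrite qu.
pose f (p : R * quot E) := (p.1, sec p.2).
exists ((quot_proj E \o g) \o f); split.
- apply: (@within_continuous_composition _ _ _ _ ((`[0, 1]%classic : set R) `*` A) f).
  + apply: continuous_at_within => -[s q] [/= _ [a Aa aq]] W fW.
    move: aq fW; have [u -> ua] := quot_proj_out (AE' _ Aa) => <- [[B1 B2]] /= [B1s].
    move=> /quot_nbhs_Some B2u B12.
    exists (B1, [set q | if q is Some v then B2 (set_val v) else False]) => //.
    by move=> [s' [v|]] [] //= B1s' B2v; exact: (B12 (s', set_val v)).
  + apply: (@within_continuous_composition _ _ _ _ setT g) => //.
    by apply: continuous_subspaceT; exact: quot_proj_continuous.
  + by move=> _ [[s q] [/= ? [a Aa <-]] <-]; split=> //=; rewrite secK.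
- by move=> _ [a Aa <-]; rewrite /f /= secK// g0.
- by move=> _ _ [a Aa <-] [b Ab <-]; rewrite /f /= !secK// (g1 a b).
Qed.

(** The flow homotopy fixes [E], so it descends to a function on the quotient. Its continuity at the
    collapsed point comes from the compactness of [[0, 1]]. *)
Lemma deformable_quot (Psi : R -> Z -> Z) (T : R) (A : set Z) :
  continuous (fun p : R * Z => Psi p.1 p.2) -> (forall x, Psi 0 x = x) ->
  (forall t x, E x -> Psi t x = x) -> (forall x, A x -> E (Psi T x)) ->
  deformable R [set quot_pt E] (quot_pt E |` quot_proj E @` A) [set quot_pt E].
Proof.
move=> cPsi Psi0 PE AT; split; first by move=> _ ->; split=> //; left.
pose G (p : R * Z) := quot_proj E (Psi (p.1 * T + 0) p.2).
have cG : continuous G.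
  move=> p; apply: (@continuous_comp _ _ _ (fun p : R * Z => Psi (p.1 * T + 0) p.2) (quot_proj E)).
    apply: (@flow_homotopy_continuous _ _ _ cPsi (fun s : R => s * T + 0)).
    exact: scale_continuous.
  exact: quot_proj_continuous.
pose h (p : R * quot E) : quot E := if p.2 is Some u then G (p.1, set_val u) else quot_pt E.
have hG s x : h (s, quot_proj E x) = G (s, x).
  have [Ex|/quot_proj_out[u -> <-]//] := pselect (E x).
  by rewrite quot_proj_in// /h /G /= PE// quot_proj_in.
exists h; split=> [|x [-> //|[a Aa <-]]|x [-> //|[a Aa <-]]|s y _ -> //].
- apply/subspace_continuousP => -[s q] _ W hW.
  suff : nbhs (s, q) [set p | 0 <= p.1 <= 1 -> W (h p)].
    rewrite !nbhs_simpl /= /within /=; apply: filterS => -[s' q'] + [/=].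
    by rewrite in_itv => /[apply].
  case: q hW => [u|] hW.
    have : nbhs (s, set_val u) (G @^-1` W) by exact: cG.
    case=> -[B1 B2] /= [B1s /quot_nbhs_Some B2u] B12.
    exists (B1, [set q | if q is Some v then B2 (set_val v) else False]) => //.
    by move=> [s' [v|]] [] //= B1s' B2v _; exact: (B12 (s', set_val v)).
  move: hW; rewrite nbhsE => -[Q [oQ /= QE] QW].
  (* By the tube lemma this open set contains [E]; hence it is the preimage of a neighborhood of the
     collapsed point. *)
  pose H := [set x | forall s : R, 0 <= s <= 1 -> Q (G (s, x))]°.
  have EH : E `<=` H.
    move=> x Ex; apply: (@near_segment _ _ (fun p => Q (G p)) 1 x) => t _; apply: cG.
    by apply: open_nbhs_nbhs; split=> //; rewrite /G /= PE// quot_proj_in.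
  exists (setT, [set q : quot E | if q is Some v then H (set_val v) else True]) => /=.
    split; first exact: filterT.
    apply: open_nbhs_nbhs; split=> //; rewrite quot_openE.
    rewrite (_ : _ @^-1` _ = H); first exact: open_interior.
    apply/seteqP; split=> z /=.
      by have [Ez _|/quot_proj_out[v -> <-]//] := pselect (E z); exact: EH.
    by move=> Hz; have [Ez|/quot_proj_out[v -> ->]//] := pselect (E z); rewrite quot_proj_in.
  move=> [s' [v|]] [] //= _; last by move=> _ _; apply: QW.
  by move=> /interior_subset Hv s01; apply: QW; exact: Hv.
- by rewrite hG /G /= mul0r addr0 Psi0.
- by rewrite hG /G /= mul1r addr0 quot_proj_in//; exact: AT.
Qed.

End quotient_homotopies.

(** * The semiflow stopped at the exit set *)

Lemma pos_part_continuous {R : realType} : continuous (fun s : R => Num.max s 0).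
Proof.
by move=> s; apply: (@continuous_max _ _ id (fun=> 0)) => //; exact: cvg_cst.
Qed.

Lemma lt_ereal_between {R : realType} (a : R) (b : \bar R) :
  (a%:E < b)%E -> exists2 c, a < c & (c%:E < b)%E.
Proof.
case: b => [b|_|//]; last by exists (a + 1); rewrite ?ltrDl ?ltr01 ?ltry.
by rewrite lte_fin => ab; exists ((a + b) / 2); rewrite ?lte_fin; lra.
Qed.

Section clamped_semiflow.
Context {R : realType} {X : topologicalType} (Phi : local_semiflow R X).

(** The domain of [Phi] is open only relative to nonnegative times. Clamping the time at 0 gives
    statements on full neighborhoods in [R * X]. *)
Let clamp (p : R * X) : R * X := (Num.max p.1 0, p.2).

Let clamp_continuous : continuous clamp.
Proof.
apply: pair_continuous; last exact: snd_continuous.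
move=> p; apply: (@continuous_comp _ _ _ fst (fun s : R => Num.max s 0)).
  exact: fst_continuous.
exact: pos_part_continuous.
Qed.

Let clamp_id (t : R) (x : X) : 0 <= t -> clamp (t, x) = (t, x).
Proof. by move=> t0; rewrite /clamp /= max_l. Qed.

Lemma sf_near_domain (t : R) x : 0 <= t -> (t%:E < sf_time Phi x)%E ->
  \forall p \near (t, x), ((Num.max p.1 0)%:E < sf_time Phi p.2)%E.
Proof.
move=> t0 tx; have [U oU UE] := sf_open Phi.
have Utx : U (clamp (t, x)).
  by rewrite clamp_id//; have [] : (U `&` [set p | 0 <= p.1]) (t, x) by rewrite -UE.
have : \forall p \near (t, x), U (clamp p).
  by apply: (@clamp_continuous (t, x)); apply: open_nbhs_nbhs.
apply: filterS => p Up.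
have : (U `&` [set p | 0 <= p.1]) (clamp p) by split=> //=; rewrite le_max lexx orbT.
by rewrite -UE => -[].
Qed.

Lemma sf_cvg (t : R) x : 0 <= t -> (t%:E < sf_time Phi x)%E ->
  Phi (Num.max p.1 0) p.2 @[p --> (t, x)] --> Phi t x.
Proof.
move=> t0 tx W PW.
have /subspace_continuousP/(_ (t, x) _ _ PW) := @sf_continuous _ _ Phi.
have tx' : semiflow_domain (sf_time Phi) (t, x) by [].
move=> /(_ tx'); rewrite !nbhs_simpl /= /within /= => tW.
have := @clamp_continuous (t, x)
  [set q | semiflow_domain (sf_time Phi) q -> W (Phi q.1 q.2)].
rewrite clamp_id// => /(_ tW) h.
suff : \forall p \near (t, x), W (Phi (Num.max p.1 0) p.2) by [].
have h' : \forall p \near (t, x), semiflow_domain (sf_time Phi) (clamp p) ->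
    W (Phi (clamp p).1 (clamp p).2) by exact: h.
apply: filterS2 h' (sf_near_domain t0 tx) => p hp pT; apply: hp.
by split; rewrite //= le_max lexx orbT.
Qed.

Lemma sf_near (t : R) x (Q : set X) : 0 <= t -> (t%:E < sf_time Phi x)%E ->
  open Q -> Q (Phi t x) ->
  \forall p \near (t, x), ((Num.max p.1 0)%:E < sf_time Phi p.2)%E /\
    Q (Phi (Num.max p.1 0) p.2).
Proof.
move=> t0 tx oQ Qtx; apply: filterI; first exact: sf_near_domain.
by apply: (sf_cvg t0 tx); apply: open_nbhs_nbhs.
Qed.

End clamped_semiflow.

Section stopped_semiflow.
Context {R : realType} {X : topologicalType} (Phi : local_semiflow R X).
Context (N E : set X).
Local Notation T := (sf_time Phi).
Local Notation H := (closure (N `\` E)).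

Context (cN : closed N).
Context (cE : closed E).
Context (EN : E `<=` N).
Context (N_exit : exit_set Phi N E).
Context (N_adm : strongly_admissible Phi H).
Context (N_trans : transversal_pair Phi N E).

Let HN : H `<=` N.
Proof. by rewrite [X in _ `<=` X]((closure_id N).1 cN); apply: closure_subset => x []. Qed.

(* [tau] is the time [t] (or [0] if [t < 0]), or the entrance time into [E] if
   it comes first. *)
Definition stops_at (t : R) (x : X) (tau : R) : Prop :=
  [/\ 0 <= tau <= Num.max t 0, (tau%:E < T x)%E,
      forall s, 0 <= s -> s < tau -> ~ E (Phi s x) &
      tau = Num.max t 0 \/ E (Phi tau x)].

Lemma stops_at_uniq t x a b : stops_at t x a -> stops_at t x b -> a = b.
Proof.
have lem c d : stops_at t x c -> stops_at t x d -> d <= c.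
  move=> [/andP[c0 cm] _ _ cE'] [/andP[d0 dm] _ dE _]; rewrite leNgt; apply/negP => cd.
  case: cE' => [cm'|]; last exact: dE.
  by move: cd; rewrite cm' ltNge dm.
by move=> sa sb; apply/eqP; rewrite eq_le !lem.
Qed.

(** A trajectory outside [N] at time [s] must have met [E] by its exit time, which is at most [s].
    Meeting [E] earlier than [s] is excluded by assumption, and meeting it exactly at [s] puts the
    point in [N]. *)
Lemma stays_before_exit x s : N x -> 0 <= s -> (s%:E < T x)%E ->
  (forall u, 0 <= u -> u < s -> ~ E (Phi u x)) -> N (Phi s x).
Proof.
move=> Nx s0 sT sE; apply: contrapT => Ns.
have es : (exit_time Phi N x <= s%:E)%E.
  by apply: ereal_inf_lbound; exists s => //; split=> //; right.
have [u [u0 ue Eu]] := N_exit.2 x Nx (le_lt_trans es sT).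
have : u <= s by rewrite -lee_fin (le_trans ue).
rewrite le_eqVlt => /predU1P[us|us]; last exact: (sE u).
by apply: Ns; apply: EN; rewrite -us.
Qed.

(** If [E] is not met up to time [m], strong admissibility prevents blow-up by then and the
    trajectory stops at [m]. Otherwise it stops at the infimum of the times in [E], attained because
    [E] is closed. *)
Lemma stops_at_exists t x : N x -> exists tau, stops_at t x tau.
Proof.
move=> Nx; set m := Num.max t 0.
have m0 : 0 <= m by rewrite le_max lexx orbT.
pose A := [set s | [/\ 0 <= s, s <= m, (s%:E < T x)%E & E (Phi s x)]].
have [A0|/set0P[a [a0 am aT Ea]]] := eqVneq A set0.
  have nE s : 0 <= s -> s <= m -> (s%:E < T x)%E -> ~ E (Phi s x).
    by move=> s0 sm sT Es; have : A s by []; rewrite A0.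
  have mT : (m%:E < T x)%E.
    rewrite ltNge; apply/negP => Tm.
    (* If existence ended by [m], the whole trajectory would lie in [N \ E]. *)
    suff : T x = +oo%E by move=> Too; rewrite Too leye_eq in Tm.
    apply: N_adm.2 => s s0 sT; apply: subset_closure.
    have nE' u : 0 <= u -> u <= s -> ~ E (Phi u x).
      move=> u0 us; have uT : (u%:E < T x)%E by apply: le_lt_trans sT; rewrite lee_fin.
      by apply: nE => //; rewrite -lee_fin (le_trans (ltW uT)).
    split; last exact: nE'.
    by apply: stays_before_exit => // u u0 /ltW; exact: nE'.
  exists m; split; [by rewrite m0 lexx|by []| |by left].
  move=> s s0 /ltW sm; apply: nE => //; apply: le_lt_trans mT.
  by rewrite lee_fin.
have Aa : A a by [].
have lbA : lbound A 0 by move=> s [].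
have hA : has_inf A by split; [exists a|exists 0].
pose i := inf A.
have i0 : 0 <= i by apply: lb_le_inf => //; exists a.
have iA s : A s -> i <= s by move=> As; apply: ge_inf => //; exists 0.
have im : i <= m by apply: le_trans am; exact: iA.
have iT : (i%:E < T x)%E by apply: le_lt_trans aT; rewrite lee_fin; exact: iA.
exists i; split; [by rewrite i0| by []| |right].
  move=> s s0 si Es; suff : i <= s by rewrite leNgt si.
  apply: iA; split=> //; first exact: le_trans (ltW si) im.
  by apply: lt_trans iT; rewrite lte_fin.
apply: contrapT => Ei.
have := sf_near i0 iT (closed_openC cE) Ei.
move=> [[B1 B2] /= [B1i /nbhs_singleton B2x] BE].
move: B1i => /nbhs_ballP[d /= d0 dB].
have [s As sd] := inf_adherent d0 hA.
have [s0 _ _ Es] := As.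
have [|_] := BE (s, x).
  split=> //=; apply: dB; rewrite /ball /= ltr_distl.
  by move: sd (iA s As); rewrite -/i => sd lis; apply/andP; split; lra.
by rewrite /= max_l.
Qed.

Definition stop_time (t : R) (x : X) : R := xget 0 (stops_at t x).

Lemma stop_timeP t x : N x -> stops_at t x (stop_time t x).
Proof.
move=> /(stops_at_exists t)[tau st]; rewrite /stop_time.
by case: xgetP => [y -> //|/(_ tau)].
Qed.

Lemma stop_time_ge0 t x : N x -> 0 <= stop_time t x.
Proof. by move=> /(stop_timeP t)[/andP[]]. Qed.

Lemma stop_time_le t x : N x -> stop_time t x <= Num.max t 0.
Proof. by move=> /(stop_timeP t)[/andP[]]. Qed.

Lemma stop_timeT t x : N x -> ((stop_time t x)%:E < T x)%E.
Proof. by move=> /(stop_timeP t)[]. Qed.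

Lemma stop_time_eq t x tau : N x -> stops_at t x tau -> stop_time t x = tau.
Proof. move=> Nx; apply: stops_at_uniq; exact: stop_timeP. Qed.

Lemma stop_N t x s : N x -> 0 <= s -> s <= stop_time t x -> N (Phi s x).
Proof.
move=> Nx s0 st; have [_ tT tE _] := stop_timeP t Nx.
apply: stays_before_exit => //; first by apply: le_lt_trans tT; rewrite lee_fin.
by move=> u u0 us; apply: tE => //; exact: lt_le_trans st.
Qed.

Lemma stop_H t x s : N x -> 0 <= s -> s < stop_time t x -> H (Phi s x).
Proof.
move=> Nx s0 st; have [_ _ tE _] := stop_timeP t Nx.
by apply: subset_closure; split; [apply: stop_N (ltW st)|exact: tE].
Qed.

(** * Continuity of the stopping time *)

Local Notation Z := (set_type N).

Lemma near_subset (t : R) (x : Z) (P : R * X -> Prop) :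
  (\forall p \near (t, set_val x), P p) -> \forall q \near (t, x), P (q.1, set_val q.2).
Proof.
move=> [[A B] /= [tA xB] AB]; exists (A, set_val @^-1` B) => /=.
  by split=> //; exact: (@initial_continuous Z X set_val x).
by move=> [s y] [/= As By]; exact: (AB (s, set_val y)).
Qed.

(** The trajectory avoids the closed set [E] on [[0, a]], and by the tube lemma so do nearby
    ones. *)
Lemma stop_time_lower (t : R) (x : Z) a : a < stop_time t (set_val x) ->
  \forall q \near (t, x), a < stop_time q.1 (set_val q.2).
Proof.
have NZ (y : Z) : N (set_val y) by exact: set_valP.
move=> ax; have [a0|a0] := ltP a 0.
  by apply: filterE => q; apply: lt_le_trans a0 _; exact: stop_time_ge0.
have [_ tT tE _] := stop_timeP t (NZ x).
have : \forall y \near set_val x, forall s : R, 0 <= s <= a ->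
    ((Num.max s 0)%:E < T y)%E /\ ~ E (Phi (Num.max s 0) y).
  apply: (@near_segment _ _ (fun p => ((Num.max p.1 0)%:E < T p.2)%E /\
    ~ E (Phi (Num.max p.1 0) p.2))).
  move=> s /andP[s0 sa].
  apply: (@sf_near _ _ _ _ _ (~` E)) => //.
  - by apply: le_lt_trans tT; rewrite lee_fin (le_trans sa)// ltW.
  - by rewrite openC.
  - by apply: tE => //; exact: le_lt_trans ax.
move=> xE.
have : \forall q \near (t, set_val x), (a < Num.max q.1 0) /\
   forall s : R, 0 <= s <= a -> ~ E (Phi s q.2).
  exists ([set s | a < Num.max s 0], [set y | forall s : R, 0 <= s <= a -> ~ E (Phi s y)]) => //=.
  split.
    apply: (cvgr_gt _ (@pos_part_continuous R t)).
    exact: lt_le_trans ax (stop_time_le t (NZ x)).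
  apply: filterS xE => y yE s sa; case: (yE s sa) => _; rewrite max_l//.
  by case/andP: sa.
move=> /near_subset; apply: filterS => -[s y] [/= as0 yE].
rewrite ltNge; apply/negP => sa.
have [/andP[u0 _] _ _ [us|]] := stop_timeP s (NZ y).
  by move: sa; rewrite us leNgt as0.
by apply: yE; rewrite u0.
Qed.

(** Before stopping, a trajectory lies in [H], and being outside the closed set [H] at time [u] is
    an open condition. *)
Lemma stop_time_near_le (u : R) (x : Z) : 0 <= u -> (u%:E < T (set_val x))%E ->
  ~ H (Phi u (set_val x)) -> \forall y \near x, forall t, stop_time t (set_val y) <= u.
Proof.
have NZ (y : Z) : N (set_val y) by exact: set_valP.
move=> u0 uT uH.
have oH : open (~` H) by rewrite openC; exact: closed_closure.
have [[A B] /= [uA xB] AB] := sf_near u0 uT oH uH.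
have : nbhs x (set_val @^-1` B) by exact: (@initial_continuous Z X set_val x).
apply: filterS => y By t; rewrite leNgt; apply/negP => ut.
have [_] := AB (u, set_val y) (conj (nbhs_singleton uA) By).
by rewrite /= max_l//; apply; exact: stop_H ut.
Qed.

(* Otherwise nearby points would stay in [N \ E] until shortly after [tau], so
   that the trajectory of [e] would stay in [H] for a short time, hence in
   [H `&` E] by positive invariance, against transversality. *)
Lemma stop_time_upper (t : R) (x : Z) b : stop_time t (set_val x) < b ->
  \forall q \near (t, x), stop_time q.1 (set_val q.2) < b.
Proof.
have NZ (y : Z) : N (set_val y) by exact: set_valP.
set tau := stop_time t (set_val x) => taub.
have near_le u : 0 <= u -> (u%:E < T (set_val x))%E -> u < b ->
    ~ H (Phi u (set_val x)) -> \forall q \near (t, x), stop_time q.1 (set_val q.2) < b.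
  move=> u0 uT ub /(stop_time_near_le u0 uT) xu.
  exists (setT, [set y | forall t, stop_time t (set_val y) <= u]) => /=.
    by split=> //; exact: filterT.
  by move=> [s y] [/= _ /(_ s) su]; exact: le_lt_trans ub.
have [/andP[tau0 _] tauT tauE [taut|Etau]] := stop_timeP t (NZ x);
    rewrite -/tau in tau0 tauT tauE *.
  exists ([set s | Num.max s 0 < b], setT) => /=.
    split; last exact: filterT.
    by apply: (cvgr_lt _ (@pos_part_continuous R t)); rewrite -taut.
  by move=> [s y] [/= sb _]; apply: le_lt_trans sb; exact: stop_time_le.
pose e := Phi tau (set_val x).
have [He|] := pselect (H e); last exact: near_le.
(* Staying below [d] keeps [s + tau] within the existence time of [x], as the semigroup law
   requires. *)
have [d taud dT] := lt_ereal_between tauT.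
have [|s [s0 sd sT sHE]] := @N_trans e (Num.min b d - tau) (conj He Etau).
  by rewrite subr_gt0 lt_min taub.
have /andP[sb sd'] : (s + tau < b) && (s + tau < d) by rewrite -lt_min -ltrBrDr.
have comp u : 0 <= u -> u <= s -> Phi u e = Phi (u + tau) (set_val x).
  move=> u0 us; have [|//] := @sf_comp _ _ Phi u tau (set_val x) u0 tau0.
  by apply: lt_trans dT; rewrite lte_fin (le_lt_trans _ sd')// lerD2r.
have [[u [u0 us uH]]|allH] :=
    pselect (exists u, [/\ 0 <= u, u <= s + tau & ~ H (Phi u (set_val x))]).
  apply: (near_le u) => //; last exact: le_lt_trans sb.
  by apply: lt_trans dT; rewrite lte_fin (le_lt_trans us).
have {}allH u : 0 <= u -> u <= s + tau -> H (Phi u (set_val x)).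
  by move=> u0 us; apply: contrapT => uH; apply: allH; exists u.
exfalso; apply: sHE; split.
  by rewrite comp ?(ltW s0)//; apply: allH => //; rewrite addr_ge0// ltW.
have [|_] := N_exit.1 e s (EN Etau) Etau (ltW s0); last by apply; rewrite ?(ltW s0).
split=> // u u0 us; rewrite comp//; apply: HN; apply: allH; first exact: addr_ge0.
by rewrite lerD2r.
Qed.

Lemma stop_time_continuous :
  continuous (fun q : R * Z => stop_time q.1 (set_val q.2)).
Proof.
move=> [t x]; apply/cvgrPdist_lt => e e0.
have := @stop_time_lower t x (stop_time t (set_val x) - e).
have := @stop_time_upper t x (stop_time t (set_val x) + e).
rewrite ltrDl gtrBl => /(_ e0) h1 /(_ e0) h2.
apply: filterS2 h1 h2 => q q1 q2 /=.
by rewrite ltr_norml; apply/andP; split; lra.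
Qed.

(** Under the hypotheses on [N] and [E] the stopped point is in [N], so [insubd] never returns its
    default [x]. *)
Definition stopped (t : R) (x : Z) : Z :=
  insubd x (Phi (stop_time t (set_val x)) (set_val x)).

Lemma stoppedE t x : set_val (stopped t x) = Phi (stop_time t (set_val x)) (set_val x).
Proof.
have Nx : N (set_val x) by exact: set_valP.
rewrite /stopped set_valE insubdK//; apply/mem_set; apply: (@stop_N t) => //.
exact: stop_time_ge0.
Qed.

Lemma stopped_continuous : continuous (fun q : R * Z => stopped q.1 q.2).
Proof.
pose c (q : R * Z) := (stop_time q.1 (set_val q.2), set_val q.2).
have cc : continuous c.
  apply: pair_continuous; first exact: stop_time_continuous.
  move=> q; apply: (@continuous_comp _ _ _ snd (set_val : Z -> X)).
    exact: snd_continuous.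
  exact: initial_continuous.
have cE' : set_val \o (fun q : R * Z => stopped q.1 q.2) =
    (fun p => Phi (Num.max p.1 0) p.2) \o c.
  apply/funext => -[t x]; rewrite /= stoppedE max_l//.
  by apply: stop_time_ge0; exact: set_valP.
apply: (@continuous_comp_initial _ _ _ set_val); rewrite cE' => -[t x].
have Nx : N (set_val x) by exact: set_valP.
have := sf_cvg (stop_time_ge0 t Nx) (stop_timeT t Nx).
move=> /(cvg_comp c _ (cc (t, x))).
by rewrite /continuous_at /= max_l//; exact: stop_time_ge0.
Qed.

Lemma stopped0 x : stopped 0 x = x.
Proof.
apply: val_inj; rewrite -!set_valE stoppedE (@stop_time_eq _ _ 0) ?sf_map0//.
  exact: set_valP.
split; [by rewrite maxxx lexx|exact: sf_time_gt0| |by left; rewrite maxxx].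
by move=> s s0 /lt_geF; rewrite s0.
Qed.

Lemma stop_time_exit t x : E x -> stop_time t x = 0.
Proof.
move=> Ex; apply: stop_time_eq; first exact: EN.
split; [by rewrite lexx le_max lexx orbT|exact: sf_time_gt0| |by right; rewrite sf_map0].
by move=> s s0 /lt_geF; rewrite s0.
Qed.

Lemma stopped_exit t (x : Z) : E (set_val x) -> stopped t x = x.
Proof.
by move=> Ex; apply: val_inj; rewrite -!set_valE stoppedE stop_time_exit// sf_map0.
Qed.

Lemma stop_time_full t x : 0 <= t -> ~ E (set_val (stopped t x)) -> stop_time t (set_val x) = t.
Proof.
move=> t0; rewrite stoppedE; have [_ _ _ [->|//]] := stop_timeP t (set_valP x).
by rewrite max_l.
Qed.

Lemma stopped_add s t x : 0 <= s -> 0 <= t -> stopped (s + t) x = stopped s (stopped t x).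
Proof.
move=> s0 t0; have Nx : N (set_val x) by exact: set_valP.
have [/andP[c0 cm] cT cE' cst] := stop_timeP (s + t) Nx.
move: c0 cm cT cE' cst; set c := stop_time _ _ => c0 cm cT cE' cst.
have st0 : 0 <= s + t by exact: addr_ge0.
rewrite (max_l st0) in cm cst.
(* Either [E] is reached before [t] and both sides rest there, or the first run lasts the full time
   [t] and the second stops after [c - t]. *)
have [ct|tc] := ltP c t.
  have Ec : E (Phi c (set_val x)) by case: cst => // cst; move: ct; rewrite cst; lra.
  have ct' : stop_time t (set_val x) = c.
    by apply: stop_time_eq => //; split=> //; [rewrite c0 max_l// ltW|right].
  have Et : E (set_val (stopped t x)) by rewrite stoppedE ct'.
  rewrite (stopped_exit s Et); apply: val_inj; rewrite -!set_valE !stoppedE ct' //.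
have tx : stop_time t (set_val x) = t.
  apply: stop_time_eq => //; split; [by rewrite t0 max_l/=| | |by left; rewrite max_l].
    by apply: le_lt_trans cT; rewrite lee_fin.
  by move=> u u0 ut; apply: cE' => //; exact: lt_le_trans tc.
have xt : set_val (stopped t x) = Phi t (set_val x) by rewrite stoppedE tx.
have comp u : 0 <= u -> u + t <= c ->
    (u%:E < T (Phi t (set_val x)))%E /\ Phi (u + t) (set_val x) = Phi u (Phi t (set_val x)).
  by move=> u0 uc; apply: sf_comp => //; apply: le_lt_trans cT; rewrite lee_fin.
have ct0 : 0 <= c - t by rewrite subr_ge0.
have [|cT' cP] := comp (c - t) ct0; first by rewrite subrK.
have st : stop_time s (Phi t (set_val x)) = c - t.
  apply: stop_time_eq; first by rewrite -xt; exact: set_valP.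
  split=> //; first by rewrite ct0 max_l//=; lra.
    move=> u u0 uct; have [|_ <-] := comp u u0; first by lra.
    by apply: cE'; [exact: addr_ge0|lra].
  rewrite max_l// -cP subrK; case: cst => [->|]; [by left; lra|by right].
by apply: val_inj; rewrite -!set_valE !stoppedE -/c tx st -cP subrK.
Qed.

End stopped_semiflow.

(** * Counting equilibria *)

Lemma card_le_uniq_seq {T : eqType} {U : Type} (l : seq T) (f : T -> U) (S : set U) :
  uniq l -> injective f -> (forall x, x \in l -> S (f x)) -> (`I_(size l) #<= S)%card.
Proof.
case: l => [|e l] ul injf lS; first by rewrite II0 card_ge0.
pose g i := f (nth e (e :: l) i).
have gS : g @` `I_(size (e :: l)) `<=` S.
  by move=> _ [i il <-]; apply: lS; exact: mem_nth.
apply: card_le_trans (subset_card_le gS).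
have /card_eqPle[] // : (g @` `I_(size (e :: l)) #= `I_(size (e :: l)))%card.
apply: inj_card_eq => i j /set_mem il /set_mem jl /injf /eqP.
by rewrite nth_uniq// => /eqP.
Qed.

Lemma contractible_subset {R : realType} {Z : topologicalType} (A B : set Z) :
  A `<=` B -> contractible_in R B -> contractible_in R A.
Proof.
move=> AB [h [hc h0 h1]]; exists h; split.
- by apply: continuous_subspaceW hc => -[s x] [/= s01 /AB].
- by move=> u /AB; exact: h0.
- by move=> u v /AB Bu /AB; exact: h1.
Qed.

Lemma finite_isolated {R : realType} {Z : metricType R} (e : Z) (l : seq Z) :
  exists2 r : R, 0 < r & forall x, x \in l -> x != e -> r <= mdist e x.
Proof.
elim: l => [|x l [r r0 rl]]; first by exists 1.
have [->|xe] := eqVneq x e.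
  exists r => // y; rewrite inE => /predU1P[->|]; last exact: rl.
  by rewrite eqxx.
exists (Num.min r (mdist e x)); first by rewrite lt_min r0 mdist_gt0 eq_sym.
move=> y; rewrite inE => /predU1P[-> _|yl ye]; first by rewrite ge_min lexx orbT.
by rewrite ge_min rl.
Qed.

(** * The stopped semiflow as a gradient semiflow *)

Section wazewski.
Context {R : realType} {X : metricType R} (Phi : local_semiflow R X) (N E : set X).
Context (V : X -> R) (cN : closed N) (cE : closed E) (EN : E `<=` N).
Context (N_exit : exit_set Phi N E).
Context (N_adm : strongly_admissible Phi (closure (N `\` E))).
Context (N_trans : transversal_pair Phi N E).
Context (cV : continuous V).
Context (V_le : forall (x : X) (s t : R), 0 <= s -> s <= t ->
  (t%:E < sf_time Phi x)%E -> V (Phi t x) <= V (Phi s x)).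
Context (V_cst : forall x, sf_time Phi x = +oo%E ->
  (forall t, 0 <= t -> V (Phi t x) = V x) -> equilibrium Phi x).

Local Notation Z := (set_type N).
Let EZ : set Z := set_val @^-1` E.
Let K : set Z := [set z | ~ EZ z /\ equilibrium Phi (set_val z)].
Let Psi : R -> Z -> Z := @stopped R X Phi N E.

Let NZ (z : Z) : N (set_val z). Proof. exact: set_valP. Qed.

Let val_continuous : continuous (set_val : Z -> X).
Proof. exact: initial_continuous. Qed.

(** Outside [E] no stopping has taken place yet, so statements about [Psi] there transfer to
    [Phi]. *)
Let no_exit t z : 0 <= t -> ~ EZ (Psi t z) ->
  [/\ (t%:E < sf_time Phi (set_val z))%E, set_val (Psi t z) = Phi t (set_val z) &
      forall s, 0 <= s -> s <= t -> closure (N `\` E) (Phi s (set_val z))].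
Proof.
move=> t0 tE.
have tt : stop_time Phi E t (set_val z) = t.
  by apply: (stop_time_full cE EN N_exit N_adm) tE.
have tT := stop_timeT cE EN N_exit N_adm t (NZ z).
have tz : set_val (Psi t z) = Phi t (set_val z) by rewrite (stoppedE cE EN N_exit N_adm) tt.
rewrite tt in tT; split=> // s s0.
rewrite le_eqVlt => /predU1P[->|st].
  apply: subset_closure; split; last by rewrite -tz.
  by rewrite -tz; exact: NZ.
by apply: (stop_H cE EN N_exit N_adm (t := t)) => //; rewrite tt.
Qed.

Lemma wazewski_gradient_semiflow : gradient_semiflow Psi EZ K (V \o set_val).
Proof.
have PsiE := stoppedE cE EN N_exit N_adm.
split.
- exact: stopped_continuous.
- exact: stopped0.
- by move=> s t x; exact: stopped_add.
- exact: closed_preimage.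
- by move=> t x; exact: stopped_exit.
(* On [E] the stopping time for [t = 1] is 0, hence it is below 1 nearby, and stopping before time 1
   means having entered [E]. *)
- move=> x Ex; exists 1 => //.
  have [|[A B] /= [A1 Bx] AB] :=
      stop_time_upper cN cE EN N_exit N_adm N_trans (t := 1) (x := x) (b := 1).
    by rewrite (stop_time_exit cE EN N_exit N_adm).
  apply: filterS Bx => y By; rewrite /EZ /= PsiE.
  have [_ _ _ [y1|//]] := stop_timeP cE EN N_exit N_adm 1 (NZ y).
  by have := AB (1, y) (conj (nbhs_singleton A1) By); rewrite /= y1 max_l// ltxx.
- move=> x; apply: continuous_comp; [exact: val_continuous|exact: cV].
- move=> t x t0 /=; rewrite PsiE -[in leRHS](sf_map0 Phi (set_val x)).
  apply: V_le => //; first exact: (stop_time_ge0 cE EN N_exit N_adm).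
  exact: (stop_timeT cE EN N_exit N_adm).
- by move=> x [].
- move=> t x [_ [_ xt]] t0; apply: val_inj; rewrite -!set_valE PsiE xt//.
  exact: (stop_time_ge0 cE EN N_exit N_adm).
- move=> x xE xV; split.
    by have := xE 0 (lexx 0); rewrite /Psi (stopped0 cE EN N_exit N_adm).
  apply: V_cst => [|t t0].
    (* The stopped trajectory never enters [E], so the existence time exceeds every [t]. *)
    have tT t : 0 <= t -> (t%:E < sf_time Phi (set_val x))%E.
      by move=> t0; have [] := no_exit t0 (xE t t0).
    case: (sf_time Phi _) tT => [r|//|] tT; last by have := tT 0 (lexx 0).
    have := tT (Num.max r 0); rewrite le_max lexx orbT lte_fin => /(_ isT).
    by rewrite ltNge le_max lexx.
  by have [_ <- _] := no_exit t0 (xE t t0); exact: xV.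
- move=> x t tn tE.
  have t0 n : 0 <= t n by exact: le_trans (tn n).
  have [||||k kP [l xl]] := N_adm.1 (set_val \o x) t.
  + by move=> n; have [_ _ /(_ 0 (lexx 0) (t0 n))] := no_exit (t0 n) (tE n); rewrite sf_map0.
  + exact: t0.
  + apply/cvgryPge => a; have := nbhs_infty_ger a.
    by apply: filterS => n an; exact: le_trans (tn n).
  + by move=> n; have [tT _ xH] := no_exit (t0 n) (tE n).
  have kn n : (n <= k n)%N by elim: n => // n /leq_ltn_trans; apply; exact: kP.
  exists k => //.
  have xl' : set_val (Psi (t (k n)) (x (k n))) @[n --> \oo] --> l.
    apply: cvg_trans xl; apply: near_eq_cvg; apply: nearW => n.
    by have [_ ->] := no_exit (t0 (k n)) (tE (k n)).
  (* Admissibility gives a limit in [X] only; it belongs to the closed set [N], and the convergence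
     holds in the subspace. *)
  have Nl : N l.
    by apply: (closed_cvg _ cN _ _ xl'); apply: nearW => n; exact: NZ.
  exists (exist _ l (mem_set Nl)) => W [_ [[B oB <-] /= Bl BW]].
  have : \forall n \near \oo, B (set_val (Psi (t (k n)) (x (k n)))).
    by apply: xl'; exact: open_nbhs_nbhs.
  by apply: filterS => n; exact: BW.
Qed.

End wazewski.

(** * Covers indexed by the rest points *)

Section gradient_semiflow_category.
Context {R : realType} {Z : metricType R}.
Context {Psi : R -> Z -> Z} {E K : set Z} {V : Z -> R}.
Context (gs : gradient_semiflow Psi E K V) (aneZ : ANE Z).

Lemma isolating_radius (l : seq Z) (e : Z) : K = [set` l] -> K e ->
  exists r : R, [/\ 0 < r, forall x, K x -> mdist e x != r,
    forall x, mdist e x <= r -> ~ E x & contractible_in R [set x | mdist e x <= r]].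
Proof.
move=> Kl Ke; have [r1 r10 ctr] := ANE_contractible_ball e aneZ.
have [r2 r20 lr] := finite_isolated e l.
have : \forall x \near e, ~ E x.
  apply: open_nbhs_nbhs; split; first by rewrite openC; exact: (gs_closed gs).
  exact: (gs_restE gs Ke).
move=> /nbhs_ballP[r3 /= r30 rE].
(* [r1] serves contractibility, [r2] isolation from the other rest points, [r3] distance from [E].
   Half of the minimum makes the inequalities for [r2] and [r3] strict. *)
pose m := Num.min r1 (Num.min r2 r3).
have m0 : 0 < m by rewrite !lt_min r10 r20.
have m1 : m / 2 <= r1 by rewrite (@le_trans _ _ m)// ?ge_min ?lexx//; lra.
have m23 : m / 2 < r2 /\ m / 2 < r3.
  have : m / 2 < m by lra.
  by rewrite {2}/m !lt_min => /and3P[].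
exists (m / 2); split; first by rewrite divr_gt0.
- move=> x; rewrite Kl /= => xl; have [->|xe] := eqVneq x e.
    by rewrite mdistxx eq_sym gt_eqF// divr_gt0.
  by rewrite gt_eqF// (lt_le_trans m23.1)// lr.
- by move=> x xm; apply: rE; rewrite ballEmdist /= (le_lt_trans xm) ?m23.2.
- by apply: contractible_subset ctr => x /= xm; exact: le_trans xm m1.
Qed.

Let Psi_cont := gs_continuous gs.

Lemma gradient_semiflow_relcat (l : seq Z) : uniq l -> K = [set` l] ->
  relcat_cover R E [set: Z] (size l) /\
  relcat_cover R [set quot_pt E] [set: quot E] (size l).
Proof.
move=> ul Kl; have cE := gs_closed gs.
have /choice[r rP] : forall e, exists r : R, K e ->
    [/\ 0 < r, forall x, K x -> mdist e x != r, forall x, mdist e x <= r -> ~ E x &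
        contractible_in R [set x | mdist e x <= r]].
  (* The radius 0 off [K] is a dummy that makes the choice total. *)
  move=> e; have [Ke|nKe] := pselect (K e); last by exists 0.
  by have [r rP] := isolating_radius Kl Ke; exists r.
have [|T [tau [T0 tau0 cov]]] := gs_cover gs (r := r) _ ul Kl.
  by move=> e /rP[].
pose F0 := Psi T @^-1` E.
pose B e := Psi (tau e) @^-1` [set x | mdist e x <= r e].
have cF0 : closed F0 by apply: closed_preimage => //; exact: flow_map_continuous.
have cball e : closed [set x : Z | mdist e x <= r e].
  apply: (@closed_preimage _ _ (fun x => mdist e x : R) [set s | s <= r e]).
    exact: mdist_continuous.
  exact: closed_le.
have cB e : closed (B e) by apply: closed_preimage => //; exact: flow_map_continuous.
have lK e : e \in l -> K e by rewrite Kl.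
(* Points of [E] are fixed, so one in [B e] would lie in the ball, which misses [E]. *)
have BE e : e \in l -> B e `&` E = set0.
  move=> /lK/rP[_ _ rE _]; rewrite -subset0 => x [Bx Ex]; apply: (rE x) => //.
  by move: Bx; rewrite /B /= (gs_exit gs).
have ctrB e : e \in l -> contractible_in R (B e).
  move=> /lK/rP[_ _ _ ?].
  by apply: contractible_flow_preimage => //; exact: (gs_map0 gs).
split.
  apply: (relcat_cover_seq cF0 (B := B)) => [|e el|x].
  - by apply: deformable_exit => //; [exact: (gs_map0 gs)|exact: (gs_exit gs)].
  - by split; [exact: cB|exact: ctrB].
  - exact: cov.
(* The collapsed point is added by hand, since the projection misses it when [E] is empty. *)
apply: (@relcat_cover_seq _ _ _ _ (quot_pt E |` quot_proj E @` F0) _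
   (fun e => quot_proj E @` B e)) => [||e el|q].
- apply: quot_closed; rewrite (_ : _ @^-1` _ = F0)//.
  apply/seteqP; split=> z; last by move=> F0z; right; exists z.
  move=> /= [qz|[y Fy /quot_projP[<- //|[_ Ez]]]]; last by rewrite /F0 /= (gs_exit gs).
  have [Ez|/(quot_proj_out)[u]] := pselect (E z); last by rewrite qz.
  by rewrite /F0 /= (gs_exit gs).
- by apply: (deformable_quot cE Psi_cont (gs_map0 gs) (gs_exit gs) (T := T)) => x.
- split; first by apply: quot_image_closed => //; exact: BE.
  by apply: contractible_quot_image; [|exact: BE|exact: ctrB].
- case: q => [u|]; last by left; left.
  have [Fu|[e el Bu]] := cov (set_val u).
    by left; right; exists (set_val u) => //; exact: quot_projK.
  by right; exists e => //; exists (set_val u) => //; exact: quot_projK.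
Qed.

End gradient_semiflow_category.

Theorem theorem5p2 (R : realType) (X : metricType R) (X_complete : complete_space X)
    (Phi : local_semiflow R X) (N E : set X)
    (Phi_gradient : gradient Phi)
    (NE_wazewski : wazewski_pair Phi N E)
    (NE_transversal : transversal_pair Phi N E)
    (EN : E `<=` N)
    (N_ANE : ANE (set_type N)) :
  let E_N : set (set_type N) := set_val @^-1` E in
  let S : set X := (N `\` E) `&` [set x | equilibrium Phi x] in
  at_least S (relcat R E_N [set: set_type N]) /\
  at_least S (relcat R [set quot_pt E_N] [set: quot E_N]).
Proof.
move=> E_N S.
have [fS|iS] := pselect (finite_set S); last by split; exact: infinite_at_least.
have [V [cV V_le V_cst]] := Phi_gradient.
have [cN cE N_exit N_adm] := NE_wazewski.
have gs := wazewski_gradient_semiflow cN cE EN N_exit N_adm NE_transversal cV V_le V_cst.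
set K := [set _ | _ /\ _] in gs.
have KS x : K x -> S (set_val x) by move=> [Ex eqx]; split=> //; split=> //; exact: set_valP.
have fK : finite_set K.
  apply: sub_finite_set KS _; apply: finite_preimage fS.
  by move=> x y _ _; exact: val_inj.
have [s Ks] := (finite_seqP K).1 fK.
(* Duplicates are removed so that the length of the list counts the equilibria. *)
have Kl : K = [set` undup s] by rewrite Ks; apply/seteqP; split=> x /=; rewrite mem_undup.
have [catZ catQ] := gradient_semiflow_relcat gs N_ANE (undup_uniq s) Kl.
have lS : (`I_(size (undup s)) #<= S)%card.
  apply: (card_le_uniq_seq (undup_uniq s) (f := set_val)) => [x y|x xs].
    exact: val_inj.
  by apply: KS; rewrite Kl.
by split; [exact: at_least_relcat catZ lS|exact: at_least_relcat catQ lS].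
Qed.
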